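(* Let $(X,f)$ be a dynamical system, $k,h\in\mathbb{N}$, and $x\in X$. Then $$\overline{h}_{\mathrm{cor}}(f^k,f^h(x))=\overline{h}_{\mathrm{cor}}(f^k,x),\qquad\underline{h}_{\mathrm{cor}}(f^k,f^h(x))=\underline{h}_{\mathrm{cor}}(f^k,x).$$
   Context: A dynamical system is a pair $(X,f)$ where $X=(X,\varrho)$ is a compact metric space and $f:X\to X$ is continuous; $f^k$ is the $k$-fold iterate. $\mathbb{N}=\{1,2,\dots\}$. For a continuous map $g:X\to X$ and $m\in\mathbb{N}$ let $\varrho^g_m(y,z)=\max_{0\le i<m}\varrho(g^i(y),g^i(z))$. For $x\in X$, $m,n\in\mathbb{N}$, $\varepsilon>0$, $$C^g_m(x,n,\varepsilon)=\frac1{n^2}\,\mathrm{card}\{(i,j):0\le i,j<n,\ \varrho^g_m(g^i(x),g^j(x))\le\varepsilon\},$$ $\overline{c}^g_m(x,\varepsilon)=\limsup_{n\to\infty}C^g_m(x,n,\varepsilon)$, $\underline{c}^g_m(x,\varepsilon)=\liminf_{n\to\infty}C^g_m(x,n,\varepsilon)$. The upper and lower local correlation entropies of $g$ at $x$ are $$\overline{h}_{\mathrm{cor}}(g,x)=\lim_{\varepsilon\to0}\limsup_{m\to\infty}\left(-\frac1m\right)\log\underline{c}^g_m(x,\varepsilon),\qquad \underline{h}_{\mathrm{cor}}(g,x)=\lim_{\varepsilon\to0}\liminf_{m\to\infty}\left(-\frac1m\right)\log\overline{c}^g_m(x,\varepsilon).$$ *)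

(* Defs.v *)
From HB Require Import structures.
From mathcomp Require Import all_boot all_order all_algebra.
From mathcomp Require Import all_classical all_reals all_analysis.

Set Implicit Arguments.
Unset Strict Implicit.
Unset Printing Implicit Defensive.

Import Order.TTheory GRing.Theory Num.Theory.
Import numFieldNormedType.Exports.

Local Open Scope classical_set_scope.
Local Open Scope ring_scope.

Section CorrelationEntropy.
Context {R : realType} {X : metricType R}.
Implicit Types (g : X -> X) (x y z : X) (m n : nat) (eps : R).

(* Distances are nonnegative, so the default value 0 does not affect the
   maximum when [0 < m]. *)
Definition bowen_dist g m y z : R :=
  \big[Num.max/0]_(i < m) mdist (iter i g y) (iter i g z).

Definition corr_sum g m x n eps : R :=
  #|[pred p : 'I_n * 'I_n |
       bowen_dist g m (iter p.1 g x) (iter p.2 g x) <= eps]|%:R / n%:R ^+ 2.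

Local Open Scope ereal_scope.

Definition upper_corr_int g m x eps : \bar R :=
  limn_esup (fun n => (corr_sum g m x n eps)%:E).

Definition lower_corr_int g m x eps : \bar R :=
  limn_einf (fun n => (corr_sum g m x n eps)%:E).

(* The terms [m = 0] and [n = 0] of the sequences are junk values that do not
   affect limits at infinity.  [lne] is the extended logarithm, with
   [lne 0 = -oo], and the entropies may be [+oo].  The limits for [e --> 0^'+]
   always exist, the functions of [e] being nonincreasing. *)
Definition upper_local_corr_entropy g x : \bar R :=
  lim (limn_esup (fun m => (- m%:R^-1)%:E * lne (lower_corr_int g m x e))
       @[e --> (0 : R)^'+]).

Definition lower_local_corr_entropy g x : \bar R :=
  lim (limn_einf (fun m => (- m%:R^-1)%:E * lne (upper_corr_int g m x e))
       @[e --> (0 : R)^'+]).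

End CorrelationEntropy.

(* Main.v *)
(** If [f] commutes with [g], uniform continuity of [f] sends [delta]-close
    pairs of [g]-orbit segments of [x] to [eps]-close pairs for [f x], hence
    the entropies of [g] at [f x] are at most those at [x].  Conversely the
    correlation sums at [g x] and [x] differ by [O(1/n)], so that the entropies
    at [g x] and [x] agree.  With [g = f^k], the entropies at [f^h x] lie
    between those at [x] and at [f^(k h) x = g^h x]. *)
Require Import Defs.
From mathcomp Require Import all_boot all_order all_algebra.
From mathcomp Require Import all_classical all_reals all_analysis.
Import Order.TTheory GRing.Theory Num.Theory.
Import numFieldNormedType.Exports.
Local Open Scope classical_set_scope.
Local Open Scope ring_scope.

Section ExtendedReals.
Context {R : realType}.
Local Open Scope ereal_scope.
Implicit Types u v : (\bar R)^nat.

Lemma le_limn_esup_near u v :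
  (forall e : R, (0 < e)%R -> \forall n \near \oo, u n <= v n + e%:E) ->
  limn_esup u <= limn_esup v.
Proof.
move=> uv; apply/lee_addgt0Pr => e e0.
rewrite -leeBlDr//; apply: le_ereal_inf_tmp => _ [A Aoo <-]; rewrite leeBlDr//.
apply: (@le_trans _ _ (ereal_sup (u @` (A `&` [set n | u n <= v n + e%:E])))).
  apply: ereal_inf_lbound; eexists; last by [].
  by apply: filterI => //; exact: uv.
apply: ge_ereal_sup => _ [n [An /= uvn] <-]; apply: (le_trans uvn).
by rewrite leeD2r//; apply: ereal_sup_ubound; exists n.
Qed.

Lemma le_limn_einf_near u v :
  (forall e : R, (0 < e)%R -> \forall n \near \oo, u n <= v n + e%:E) ->
  limn_einf u <= limn_einf v.
Proof.
move=> uv; rewrite /limn_einf leeN2; apply: le_limn_esup_near => e e0.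
near=> n; rewrite -leeBlDr// -fin_num_oppeD// leeN2.
by near: n; exact: uv.
Unshelve. all: by end_near. Qed.

Lemma le_limn_esup u v : (forall n, u n <= v n) -> limn_esup u <= limn_esup v.
Proof.
move=> uv; apply: le_limn_esup_near => e e0; near=> n.
by rewrite (le_trans (uv n))// leeDl// lee_fin ltW.
Unshelve. all: by end_near. Qed.

Lemma le_limn_einf u v : (forall n, u n <= v n) -> limn_einf u <= limn_einf v.
Proof.
by move=> uv; rewrite /limn_einf leeN2 le_limn_esup// => n; rewrite leeN2.
Qed.

Lemma le_lne (a b : \bar R) : a <= b -> lne a <= lne b.
Proof.
move=> ab; have [a0|a0] := leP a 0; first by rewrite le0_lneNy ?leNye.
by rewrite lee_lne// in_itv/= leey andbT ?(ltW a0)// (le_trans (ltW a0)).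
Qed.

Lemma le_lim_at_right0 (A B : R -> \bar R) :
  (forall d e, (0 < d)%R -> (d <= e)%R -> A e <= A d) ->
  (forall d e, (0 < d)%R -> (d <= e)%R -> B e <= B d) ->
  (forall e, (0 < e)%R -> exists2 d, (0 < d)%R & A e <= B d) ->
  lim (A e @[e --> (0 : R)^'+]) <= lim (B e @[e --> (0 : R)^'+]).
Proof.
have cvgS (C : R -> \bar R) :
    (forall d e, (0 < d)%R -> (d <= e)%R -> C e <= C d) ->
    C e @[e --> (0 : R)^'+] --> ereal_sup (C @` `]0%R, +oo[%classic).
  move=> C_ni; apply: (nonincreasing_at_right_cvge (BInfty R false)) => //.
  by move=> d e; rewrite !in_itv/= !andbT => d0 _; exact: C_ni.
move=> A_ni B_ni AB.
have -> := cvg_lim (@ereal_hausdorff R) (cvgS _ A_ni).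
have -> := cvg_lim (@ereal_hausdorff R) (cvgS _ B_ni).
apply: ge_ereal_sup => _ [e /= + <-]; rewrite in_itv/= andbT => e0.
have [d d0 /le_trans] := AB _ e0; apply.
by apply: ereal_sup_ubound; exists d; rewrite //= in_itv/= d0.
Qed.

End ExtendedReals.

Section LocalCorrelationEntropy.
Context {R : realType} {X : metricType R}.
Implicit Types (f g : X -> X) (x y : X).

Lemma bowen_dist_leP g m y z (e : R) : 0 <= e ->
  reflect (forall i, (i < m)%N -> mdist (iter i g y) (iter i g z) <= e)
          (bowen_dist g m y z <= e).
Proof.
move=> e0; apply: (iffP (bigmax_leP _ _ _ _)) => [[_ H] i im|H].
  exact: (H (Ordinal im)).
by split=> // i _; exact: H.
Qed.

Lemma le_corr_sum g m x y n (d e : R) :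
  (forall i j, bowen_dist g m (iter i g x) (iter j g x) <= d ->
     bowen_dist g m (iter i g y) (iter j g y) <= e) ->
  corr_sum g m x n d <= corr_sum g m y n e.
Proof.
move=> xy; rewrite ler_wpM2r ?invr_ge0 ?exprn_ge0// ler_nat subset_leq_card//.
by apply/fintype.subsetP => -[i j]; rewrite !inE; exact: xy.
Qed.

Lemma le_local_corr_entropy g x y :
  (forall e : R, 0 < e -> exists2 d, 0 < d & forall m (eta : R), 0 < eta ->
     \forall n \near \oo, corr_sum g m x n d <= corr_sum g m y n e + eta) ->
  (upper_local_corr_entropy g y <= upper_local_corr_entropy g x /\
   lower_local_corr_entropy g y <= lower_local_corr_entropy g x)%E.
Proof.
pose dominated z z' d e := forall m (eta : R), 0 < eta ->
  \forall n \near \oo, corr_sum g m z n d <= corr_sum g m z' n e + eta.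
have scale m (a b : \bar R) : (a <= b)%E ->
    ((- m%:R^-1)%:E * lne b <= (- m%:R^-1)%:E * lne a)%E.
  move=> ab; rewrite EFinN !mulNe leeN2 lee_wpmul2l ?lee_fin ?invr_ge0//.
  exact: le_lne.
have upperS z z' d e : dominated z z' d e ->
    (limn_esup (fun m => (- m%:R^-1)%:E * lne (lower_corr_int g m z' e))
     <= limn_esup (fun m => (- m%:R^-1)%:E * lne (lower_corr_int g m z d)))%E.
  move=> zz'; apply: le_limn_esup => m; apply: scale.
  apply: le_limn_einf_near => eta eta0.
  by apply: filterS (zz' m _ eta0) => n; rewrite -EFinD lee_fin.
have lowerS z z' d e : dominated z z' d e ->
    (limn_einf (fun m => (- m%:R^-1)%:E * lne (upper_corr_int g m z' e))
     <= limn_einf (fun m => (- m%:R^-1)%:E * lne (upper_corr_int g m z d)))%E.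
  move=> zz'; apply: le_limn_einf => m; apply: scale.
  apply: le_limn_esup_near => eta eta0.
  by apply: filterS (zz' m _ eta0) => n; rewrite -EFinD lee_fin.
have mono z d e : 0 < d -> d <= e -> dominated z z d e.
  move=> d0 de m eta eta0; apply: nearW => n; rewrite ler_wpDr ?(ltW eta0)//.
  by apply: le_corr_sum => i j /le_trans; apply.
by move=> xy; split; apply: le_lim_at_right0 => [d e d0 de|d e d0 de|e e0];
  try (by apply: upperS; exact: mono); try (by apply: lowerS; exact: mono);
  have [d d0 xyd] := xy _ e0; exists d => //; [exact: upperS|exact: lowerS].
Qed.

Lemma compact_unif_continuous f (e : R) :
  compact [set: X] -> continuous f -> 0 < e ->
  exists2 d : R, 0 < d & forall x y, mdist x y <= d -> mdist (f x) (f y) <= e.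
Proof.
move=> /compact_near_coveringP Xc f_cont e0.
have e20 : 0 < e / 2 by rewrite divr_gt0.
pose P (d : R) x := forall y, mdist x y <= d -> mdist (f x) (f y) <= e.
suff : \forall d \near (0 : R)^'+, [set: X] `<=` P d.
  move=> H; near (0 : R)^'+ => d; exists d => // x y.
  by apply: (near H d).
apply: Xc => x _.
have /nbhs_ballP[r /= r0 xr] : nbhs x (f @^-1` ball (f x) (e / 2)).
  exact/f_cont/nbhsx_ballx.
have r20 : 0 < r / 2 by rewrite divr_gt0.
exists (ball x (r / 2), [set d | d < r / 2]).
  by split; [exact: nbhsx_ballx|exact: nbhs_right_lt].
move=> -[x' d] /= []; rewrite ballEmdist/= => xx' dr y x'y.
have close z : mdist x z < r -> mdist (f x) (f z) < e / 2.
  by move=> xz; have := xr z; rewrite /= !ballEmdist/=; exact.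
rewrite (le_trans (metric_triangle _ (f x) _))// (splitr e) metric_sym.
rewrite lerD// ltW// close//.
  by rewrite (lt_trans xx')// gtr_pMr// invf_lt1// ltr1n.
rewrite (le_lt_trans (metric_triangle _ x' _))// (splitr r) ltrD//.
exact: le_lt_trans x'y dr.
Unshelve. all: by end_near. Qed.

Lemma iter_comm f g n x : (forall y, f (g y) = g (f y)) ->
  iter n g (f x) = f (iter n g x).
Proof. by move=> fg; elim: n => //= n ->. Qed.

Lemma local_corr_entropy_comm f g x : compact [set: X] -> continuous f ->
  (forall y, f (g y) = g (f y)) ->
  (upper_local_corr_entropy g (f x) <= upper_local_corr_entropy g x /\
   lower_local_corr_entropy g (f x) <= lower_local_corr_entropy g x)%E.
Proof.
move=> Xc fc fg; apply: le_local_corr_entropy => e e0.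
have [d d0 fd] := compact_unif_continuous _ _ Xc fc e0.
exists d => // m eta eta0; apply: nearW => n.
rewrite ler_wpDr ?(ltW eta0)//; apply: le_corr_sum => i j.
move=> /(bowen_dist_leP _ _ _ _ _ (ltW d0)) H.
apply/(bowen_dist_leP _ _ _ _ _ (ltW e0)) => l lm.
by rewrite !(iter_comm _ _ _ _ fg) fd// H.
Qed.

Lemma corr_count_shift (a : nat -> nat -> bool) n :
  (#|[pred p : 'I_n * 'I_n | a p.1.+1 p.2.+1]| <=
   #|[pred p : 'I_n * 'I_n | a p.1 p.2]| + n.*2.+1)%N.
Proof.
have card_sum (b : nat -> nat -> bool) l :
    #|[pred p : 'I_l * 'I_l | b p.1 p.2]| = (\sum_(i < l) \sum_(j < l) b i j)%N.
  rewrite pair_bigA -sum1_card big_mkcond.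
  by apply: eq_bigr => -[i j] _; rewrite inE/=; case: b.
rewrite (card_sum (fun i j => a i.+1 j.+1)) card_sum.
pose S := (\sum_(i < n.+1) \sum_(j < n.+1) a i j)%N.
apply: (@leq_trans S).
  rewrite /S big_ord_recl (leq_trans _ (leq_addl _ _))//; apply: leq_sum => i _.
  by rewrite big_ord_recl leq_addl.
rewrite /S big_ord_recr/=; under eq_bigr do rewrite big_ord_recr/=.
rewrite big_split/= -addnA leq_add2l -addnn -addnS leq_add//.
all: by rewrite -[leqRHS]card_ord -sum1_card leq_sum// => i _; case: (a _ _).
Qed.

Lemma local_corr_entropy_shift g x :
  (upper_local_corr_entropy g x <= upper_local_corr_entropy g (g x) /\
   lower_local_corr_entropy g x <= lower_local_corr_entropy g (g x))%E.
Proof.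
apply: le_local_corr_entropy => e e0; exists e => // m eta eta0.
near=> n; have n0 : (0 < n)%N by near: n; exact: nbhs_infty_gt.
have n0R : 0 < n%:R ^+ 2 :> R by rewrite exprn_gt0// ltr0n.
rewrite /corr_sum ler_pdivrMr// mulrDl divfK ?gt_eqF//.
pose a i j := bowen_dist g m (iter i g x) (iter j g x) <= e.
rewrite (@eq_card _ _ [pred p : 'I_n * 'I_n | a p.1.+1 p.2.+1]); last first.
  by move=> p; rewrite !inE /a !iterSr.
have := corr_count_shift a n.
rewrite -(ler_nat R) natrD => /le_trans; apply; rewrite lerD2l.
apply: (@le_trans _ _ (3 * n%:R)).
  by rewrite -natrM ler_nat -addnn -addn1 !mulSn mul0n addn0 addnA leq_add2l.
rewrite expr2 mulrA ler_pM2r ?ltr0n// mulrC -ler_pdivrMr//.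
by near: n; exact: nbhs_infty_ger.
Unshelve. all: by end_near. Qed.

Lemma local_corr_entropy_iter_comm f g x n : compact [set: X] ->
  continuous f -> (forall y, f (g y) = g (f y)) ->
  (upper_local_corr_entropy g (iter n f x) <= upper_local_corr_entropy g x /\
   lower_local_corr_entropy g (iter n f x) <= lower_local_corr_entropy g x)%E.
Proof.
move=> Xc fc fg; elim: n => [|n [IHu IHl]]; first by split.
have [u l] := local_corr_entropy_comm f g (iter n f x) Xc fc fg.
by split; [exact: le_trans u IHu|exact: le_trans l IHl].
Qed.

Lemma local_corr_entropy_iter_shift g x n :
  (upper_local_corr_entropy g x <= upper_local_corr_entropy g (iter n g x) /\
   lower_local_corr_entropy g x <= lower_local_corr_entropy g (iter n g x))%E.
Proof.
elim: n => [|n [IHu IHl]]; first by split.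
have [u l] := local_corr_entropy_shift g (iter n g x).
by split; [exact: le_trans IHu u|exact: le_trans IHl l].
Qed.

End LocalCorrelationEntropy.

Theorem corollary13 (R : realType) (X : metricType R) (f : X -> X)
    (X_compact : compact [set: X]) (f_continuous : continuous f)
    (k h : nat) (k_gt0 : (0 < k)%N) (h_gt0 : (0 < h)%N) (x : X) :
  upper_local_corr_entropy (iter k f) (iter h f x) =
    upper_local_corr_entropy (iter k f) x /\
  lower_local_corr_entropy (iter k f) (iter h f x) =
    lower_local_corr_entropy (iter k f) x.
Proof.
have fk y : f (iter k f y) = iter k f (f y) by rewrite -iterS iterSr.
have [u1 l1] := local_corr_entropy_iter_comm f _ x h X_compact f_continuous fk.
have [u2 l2] := local_corr_entropy_iter_comm f _ (iter h f x) (h * k.-1)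
  X_compact f_continuous fk.
have [u3 l3] := local_corr_entropy_iter_shift (iter k f) x h.
have shiftE : iter h (iter k f) x = iter (h * k.-1) f (iter h f x).
  by rewrite -iterM -iterD -mulnSr prednK.
rewrite shiftE in u3 l3.
split.
  by apply: le_anti; apply/andP; split; [exact: u1|exact: le_trans u3 u2].
by apply: le_anti; apply/andP; split; [exact: l1|exact: le_trans l3 l2].
Qed.
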